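(* Let $a\ge -1$ be an integer, let $\rho$ be the largest root of $x^3-ax^2-(a+3)x-1$ and $K=\mathbb{Q}(\rho)$. If $\mathcal{O}_K=\mathbb{Z}[\rho]$, then there exist classical, additively indecomposable quadratic forms over $\mathcal{O}_K$ in $2$ variables and in $3$ variables.
   Context: $K$ is a totally real cubic field (a ''simplest cubic field''). An element of $K$ is totally positive if all its real conjugates are positive; $\mathcal{O}_K^+$ denotes the totally positive elements of $\mathcal{O}_K$. A quadratic form over $\mathcal{O}_K$ in $n$ variables is $Q=\sum_{1\le i\le j\le n}a_{ij}x_ix_j$ with $a_{ij}\in\mathcal{O}_K$; it is classical if $a_{ij}\in 2\mathcal{O}_K$ for $i\ne j$. $Q$ is totally positive semi-definite if $Q(x)\in\mathcal{O}_K^+\cup\{0\}$ for all $x\in\mathcal{O}_K^n$, and totally positive definite if additionally $Q(x)=0$ only for $x=0$. A totally positive definite classical form is additively indecomposable if it is not a sum $Q_1+Q_2$ of two nonzero classical totally positive semi-definite quadratic forms over $\mathcal{O}_K$ in the same variables. *)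

(* Defs.v *)
From HB Require Import structures.
From mathcomp Require Import all_boot all_order all_algebra all_field.
From mathcomp Require Import reals.

Set Implicit Arguments.
Unset Strict Implicit.
Unset Printing Implicit Defensive.

Import Order.TTheory GRing.Theory Num.Theory.

Local Open Scope ring_scope.

Definition simplest_cubic (F : nzRingType) (a : int) : {poly F} :=
  'X^3 - (a%:~R)%:P * 'X^2 - ((a + 3)%:~R)%:P * 'X - 1.

Definition largest_root (R : realType) (p : {poly R}) (rho : R) : Prop :=
  root p rho /\ forall y : R, root p y -> y <= rho.

(* Q(rho); the polynomial only certifies that rho is algebraic over Q, the
   resulting field is the same for every nonzero polynomial vanishing at rho. *)
Definition Qadjoin (R : realType) (a : int) (rho : R) : fieldType :=
  subFExtend (ratr : {rmorphism rat -> R}) rho (simplest_cubic rat a).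

(* rho as an element of Q(rho) *)
Definition Qgen (R : realType) (a : int) (rho : R) : Qadjoin a rho :=
  subfx_root (ratr : {rmorphism rat -> R}) rho (simplest_cubic rat a).

Section QuadraticForms.

Variables (R : realType) (K : fieldType).

Definition ring_of_integers (x : K) : Prop := integralOver (intr : int -> K) x.

(* Z[t] *)
Definition Zadjoin (t x : K) : Prop :=
  exists q : {poly int}, x = (map_poly intr q).[t].

Definition totally_positive (x : K) : Prop :=
  forall sigma : {rmorphism K -> R}, 0 < sigma x.

Definition OKplus (x : K) : Prop := ring_of_integers x /\ totally_positive x.

Variable n : nat.

(* The form sum_(i <= j) a_ij x_i x_j is encoded by its upper triangular
   matrix of coefficients (a_ij), not by its Gram matrix; so equality, sum and
   zero of matrices are those of forms. *)
Definition quadratic_form (Q : 'M[K]_n) : Prop :=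
  (forall i j, ring_of_integers (Q i j)) /\
  (forall i j : 'I_n, (j < i)%N -> Q i j = 0).

Definition qeval (Q : 'M[K]_n) (x : 'rV[K]_n) : K :=
  \sum_(i < n) \sum_(j < n | (i <= j)%N) Q i j * x 0 i * x 0 j.

Definition classical (Q : 'M[K]_n) : Prop :=
  quadratic_form Q /\
  forall i j : 'I_n, i != j ->
    exists b : K, ring_of_integers b /\ Q i j = 2 * b.

Definition integral_vector (x : 'rV[K]_n) : Prop :=
  forall i, ring_of_integers (x 0 i).

Definition totally_psd (Q : 'M[K]_n) : Prop :=
  forall x, integral_vector x -> OKplus (qeval Q x) \/ qeval Q x = 0.

Definition totally_pd (Q : 'M[K]_n) : Prop :=
  totally_psd Q /\ forall x, integral_vector x -> qeval Q x = 0 -> x = 0.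

Definition additively_indecomposable (Q : 'M[K]_n) : Prop :=
  [/\ classical Q, totally_pd Q &
    ~ exists Q1 Q2 : 'M[K]_n,
        [/\ classical Q1 /\ totally_psd Q1, classical Q2 /\ totally_psd Q2,
            Q1 <> 0, Q2 <> 0 & Q = Q1 + Q2]].

End QuadraticForms.

(* Main.v *)
(* A positive definite classical form whose diagonal entries are indecomposable
   integers, and whose nonzero off-diagonal entries form a connected graph, is
   additively indecomposable: in a splitting each diagonal entry goes to one of
   the summands, and a zero diagonal entry of a semi-definite form kills its row
   and column. Take [alpha = 1 + rho + rho^2] on the diagonal, joined to the
   first variable by the entries [rho] (two variables), or [rho] and [1 + rho]
   (three variables). Definiteness comes from
     [alpha^2 - rho^2 = (1 + rho)^2 + (rho (1 + rho))^2] and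
     [alpha^2 - rho^2 - (1 + rho)^2 = (rho (1 + rho))^2].
   The element [alpha] is indecomposable: the functional
   [p + q rho + r rho^2 |-> p + r] is positive on totally positive elements and
   equals 2 at [alpha], so both parts of a splitting of [alpha] have [p + r = 1],
   and the conjugates [- (1 + rho) / rho < -1] and [-1 < - 1 / (1 + rho) < 0]
   exclude such parts. *)
From HB Require Import structures.
Require Import Defs.
From mathcomp Require Import all_boot all_order all_algebra all_field.
From mathcomp Require Import reals ring lra zify.
Set Implicit Arguments.
Unset Strict Implicit.
Unset Printing Implicit Defensive.
Import Order.TTheory GRing.Theory Num.Theory.
Local Open Scope ring_scope.

(** * The simplest cubic polynomial: conjugate roots and irreducibility *)

Lemma simplest_cubic_horner (F : comNzRingType) (a : int) (x : F) :
  (simplest_cubic F a).[x] =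
  x ^+ 3 - a%:~R * x ^+ 2 - (a + 3)%:~R * x - 1.
Proof. by rewrite /simplest_cubic !hornerE. Qed.

Lemma map_simplest_cubic (F G : nzRingType) (f : {rmorphism F -> G}) (a : int) :
  map_poly f (simplest_cubic F a) = simplest_cubic G a.
Proof.
rewrite /simplest_cubic !rmorphB /= rmorph1 !rmorphM /=.
by rewrite !map_polyX !map_polyC /= !rmorph_int.
Qed.

Lemma size_simplest_cubic (F : nzRingType) (a : int) :
  size (simplest_cubic F a) = 4.
Proof.
have -> : simplest_cubic F a = 'X^3 + - ((a%:~R)%:P * 'X^2
   + ((a + 3)%:~R)%:P * 'X + 1) by rewrite /simplest_cubic !opprD !addrA.
rewrite size_polyDl ?size_polyXn // size_polyN.
rewrite -['X^2]/('X^(1.+1)) exprS mulrA -mulrDl size_MXaddC.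
case: ifP => // _; rewrite ltnS (leq_ltn_trans (size_polyD _ _)) //.
rewrite gtn_max (leq_ltn_trans (size_polyC_leq1 _)) // andbT.
rewrite mul_polyC (leq_ltn_trans (size_scale_leq _ _)) //.
by rewrite size_polyX.
Qed.

Lemma simplest_cubic_neq0 (F : nzRingType) (a : int) :
  simplest_cubic F a != 0.
Proof. by rewrite -size_poly_gt0 size_simplest_cubic. Qed.

Section SimplestCubicRoot.
Variables (F : fieldType) (a : int) (z : F).
Hypothesis rz : root (simplest_cubic F a) z.

Lemma simplest_cubic_root3 :
  z ^+ 3 = a%:~R * z ^+ 2 + (a + 3)%:~R * z + 1.
Proof.
move: rz => /rootP; rewrite simplest_cubic_horner => h.
by apply/eqP; rewrite -subr_eq0 -h; apply/eqP; ring.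
Qed.

Lemma simplest_cubic_root_neq0 : z != 0.
Proof.
apply/eqP => z0; move: simplest_cubic_root3.
by rewrite z0 !expr0n !mulr0 !add0r => /esym/eqP; rewrite oner_eq0.
Qed.

Lemma simplest_cubic_root_add1_neq0 : 1 + z != 0.
Proof.
apply/eqP => z0; have {z0} z1 : z = -1 by apply/eqP; rewrite -addr_eq0 addrC z0.
move: simplest_cubic_root3; rewrite z1 intrD => /eqP; rewrite -subr_eq0.
set y := (X in X == 0); have -> : y = 1 by rewrite /y; ring.
by rewrite oner_eq0.
Qed.

(** The map [z |-> - (1 + z) / z] has order 3 and permutes the roots: with [f] the cubic,
    [z^3 f(- (1 + z) / z) = f(z)]. Its square is [z |-> - 1 / (1 + z)], for which
    [(1 + z)^3 f(- 1 / (1 + z)) = - f(z)]. *)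
Lemma simplest_cubic_root_conj1 : root (simplest_cubic F a) (- (1 + z) / z).
Proof.
apply/rootP; rewrite simplest_cubic_horner intrD.
have := simplest_cubic_root3; rewrite intrD => h.
have z0 := simplest_cubic_root_neq0.
by field: h; rewrite z0.
Qed.

Lemma simplest_cubic_root_conj2 : root (simplest_cubic F a) (- 1 / (1 + z)).
Proof.
apply/rootP; rewrite simplest_cubic_horner intrD.
have := simplest_cubic_root3; rewrite intrD => h.
have z0 := simplest_cubic_root_add1_neq0.
by field: h; rewrite z0.
Qed.

End SimplestCubicRoot.

(** If [rho < -1], the conjugate [- 1 / (1 + rho)] is positive; if [-1 < rho < 0], the conjugate
    [- (1 + rho) / rho] is. Either contradicts maximality. *)
Lemma largest_root_gt0 (R : realType) (a : int) (rho : R) :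
  largest_root (simplest_cubic R a) rho -> 0 < rho.
Proof.
move=> [rr le_rho].
have z0 := simplest_cubic_root_neq0 rr.
have z1 := simplest_cubic_root_add1_neq0 rr.
have := le_rho _ (simplest_cubic_root_conj1 rr).
have := le_rho _ (simplest_cubic_root_conj2 rr).
case: (ltgtP rho 0) z0 => // rho_lt0 _.
case: (ltgtP (1 + rho) 0) z1 => // h _ h2 h1.
- suff : 0 < -1 / (1 + rho) by lra.
  by rewrite mulN1r oppr_gt0 invr_lt0.
- suff : 0 < - (1 + rho) / rho by lra.
  by rewrite mulNr oppr_gt0 pmulr_rlt0 // invr_lt0.
Qed.

(** Rational root test: a root would be an integer dividing 1, but the cubic takes the odd value
    [-2a - 3] at 1 and the value 1 at -1. *)
Lemma simplest_cubic_rat_noroot (a : int) (x : rat) :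
  ~~ root (simplest_cubic rat a) x.
Proof.
apply/negP => /simplest_cubic_root3.
have [n d cop] := ratP x => h.
have d0 : d.+1%:~R != 0 :> rat by rewrite intr_eq0.
have {}h : n ^+ 3 = (a * n ^+ 2 + (a + 3) * n * d.+1%:Z + d.+1%:Z ^+ 2)
    * d.+1%:Z.
  apply/eqP; rewrite -(eqr_int rat); apply/eqP.
  rewrite !(rmorphXn, rmorphD, rmorphM) /=.
  set t := n%:~R / _ in h.
  have -> : n%:~R = t * d.+1%:~R :> rat by rewrite divfK.
  by rewrite exprMn h intrD; ring.
have d1 : d.+1 = 1%N.
  have : (d.+1 %| `|n| ^ 3)%N.
    by rewrite -abszX h abszM dvdn_mull.
  rewrite -[(_ ^ 3)%N]muln1 Gauss_dvdr ?dvdn1 => [/eqP //|].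
  by rewrite coprimeXr // coprime_sym.
move: h; rewrite d1 => h.
have : (`|n| %| 1)%N.
  have -> : 1%N = `|(n * (n ^+ 2 - a * n - (a + 3)))%R|%N.
    rewrite -[LHS]/`|1%Z|%N; congr absz.
    by rewrite mulrBr mulrBr -exprS h; ring.
  by rewrite abszM dvdn_mulr.
rewrite dvdn1 => n1; have {n1} : n = 1 \/ n = -1 by lia.
by move=> [] nE; move: h; rewrite nE; lia.
Qed.

Lemma simplest_cubic_irreducible (a : int) :
  irreducible_poly (simplest_cubic rat a).
Proof.
apply: cubic_irreducible; first by rewrite size_simplest_cubic.
exact: simplest_cubic_rat_noroot.
Qed.

(** * Real embeddings of Q(rho) attached to the real roots of the cubic *)

Section Embedding.
Variables (R : realType) (a : int) (rho z : R).
Hypothesis rrho : root (simplest_cubic R a) rho.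
Hypothesis rz : root (simplest_cubic R a) z.

Let f := simplest_cubic rat a.
Let ev (q : {poly rat}) : R := (map_poly ratr q).[z].
Let el (q : {poly rat}) : Qadjoin a rho :=
  subfx_eval (ratr : {rmorphism rat -> R}) rho f q.

Let rrho' : root (map_poly (ratr : {rmorphism rat -> R}) f) rho.
Proof. by rewrite map_simplest_cubic. Qed.

(** Polynomials that agree at [rho] differ by a multiple of the irreducible [f], hence agree at [z].
    This makes evaluation at [z] well defined on Q(rho). *)
Let el_inj_ev p q : el p = el q -> ev p = ev q.
Proof.
move=> epq; apply/eqP; rewrite -subr_eq0 -hornerN -hornerD -rmorphB /=.
have: subfx_inj (el (p - q)) = 0.
  by rewrite /el rmorphB /= -/(el p) epq subrr rmorph0.
rewrite (subfx_inj_eval rrho' (simplest_cubic_neq0 _ _)) => /rootP rpq.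
have : ~~ coprimep f (p - q).
  rewrite -(coprimep_map (ratr : {rmorphism rat -> R})).
  by apply/negP => /coprimep_root /(_ rrho'); rewrite (rootP rpq) eqxx.
rewrite (irreducible_poly_coprime _ (simplest_cubic_irreducible a)) negbK.
rewrite -(dvdp_map (ratr : {rmorphism rat -> R})) map_simplest_cubic.
move=> fpq; rewrite -[_ == 0]/(root _ _) -dvdp_XsubCl.
by apply: dvdp_trans fpq; rewrite dvdp_XsubCl.
Qed.

(** Boolean equality lets [xchoose] select a representing polynomial. *)
Let rep (x : Qadjoin a rho) : exists q, x == el q.
Proof. by have [q ->] := subfxE x; exists q. Qed.

Definition Qadjoin_embed (x : Qadjoin a rho) : R := ev (xchoose (rep x)).

Let embedE q : Qadjoin_embed (el q) = ev q.
Proof. by apply: el_inj_ev; rewrite -(eqP (xchooseP (rep (el q)))). Qed.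

Let embed_zmod : zmod_morphism Qadjoin_embed.
Proof.
move=> x y; have [p /eqP ->] := rep x; have [q /eqP ->] := rep y.
by rewrite -rmorphB !embedE /ev rmorphB !hornerE.
Qed.

Let embed_monoid : monoid_morphism Qadjoin_embed.
Proof.
split=> [|x y]; last first.
  have [p /eqP ->] := rep x; have [q /eqP ->] := rep y.
  by rewrite -rmorphM !embedE /ev rmorphM hornerM.
have -> : 1 = el 1 by rewrite /el rmorph1.
by rewrite embedE /ev rmorph1 hornerC.
Qed.

Lemma Qadjoin_embedding :
  exists sigma : {rmorphism Qadjoin a rho -> R}, sigma (Qgen a rho) = z.
Proof.
pose aM := GRing.isZmodMorphism.Build _ _ _ embed_zmod.
pose mM := GRing.isMonoidMorphism.Build _ _ _ embed_monoid.
pose s : {rmorphism Qadjoin a rho -> R} := HB.pack Qadjoin_embed aM mM.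
exists s; rewrite /= [Qgen a rho]/(el 'X) embedE /ev.
by rewrite map_polyX hornerX.
Qed.

End Embedding.

(** * Sign arguments at the three conjugates *)

Section PositiveOnConjugates.
Variables (R : realFieldType) (z : R).
Hypothesis z_gt0 : 0 < z.

Let z0 : z != 0. Proof. by rewrite gt_eqF. Qed.
Let z1_gt0 : 0 < 1 + z. Proof. by rewrite addr_gt0. Qed.
Let z1 : 1 + z != 0. Proof. by rewrite gt_eqF. Qed.

(* The functional [p + r] is the trace form [x |-> Tr (delta * x)] of a totally
   positive element [delta] of the codifferent. *)
Lemma trace_functional_gt0 (p q r : R) :
  0 < p + q * z + r * z ^+ 2 ->
  0 < p + q * (- (1 + z) / z) + r * (- (1 + z) / z) ^+ 2 ->
  0 < p + q * (- 1 / (1 + z)) + r * (- 1 / (1 + z)) ^+ 2 ->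
  0 < p + r.
Proof.
set g0 := (X in 0 < X); set g1 := (X in _ -> 0 < X -> _).
set g2 := (X in _ -> _ -> 0 < X -> _) => h0 h1 h2.
(* Here [delta = ((1 + z) / (1 + z + z^2))^2]. Divided by [(1 + z + z^2)^2], the three weights are
   [delta] and its conjugates. *)
have e : (1 + z + z ^+ 2) ^+ 2 * (p + r) =
    (1 + z) ^+ 2 * g0 + z ^+ 2 * g1 + z ^+ 2 * (1 + z) ^+ 2 * g2.
  by rewrite /g0 /g1 /g2; field; rewrite z0 z1.
have D : 0 < 1 + z + z ^+ 2 by rewrite addr_gt0 ?exprn_gt0.
rewrite -(pmulr_rgt0 _ (exprn_gt0 2 D)) e.
by rewrite !addr_gt0 ?mulr_gt0 ?exprn_gt0.
Qed.

(** The two values are conjugates of the parts of a splitting of [1 + z + z^2], both with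
    [p + r = 1]. The first part, with constant term at most 0, is tested at [s] in (-1, 0), the
    second at [t < -1]; the sign of [q] decides which test fails. *)
Lemma no_split_on_conjugates (p q : int) : p <= 0 ->
  0 < p%:~R + q%:~R * (- 1 / (1 + z)) + (1 - p)%:~R * (- 1 / (1 + z)) ^+ 2 ->
  0 < (1 - p)%:~R + (1 - q)%:~R * (- (1 + z) / z)
      + p%:~R * (- (1 + z) / z) ^+ 2 ->
  False.
Proof.
set s := - 1 / (1 + z); set t := - (1 + z) / z => p0.
have s0 : s < 0 by rewrite /s mulN1r oppr_lt0 invr_gt0.
have s1 : -1 < s.
  by rewrite /s mulN1r ltrN2 invf_lt1 // ltrDl.
have t1 : t < -1.
  by rewrite /t mulNr ltrN2 ltr_pdivlMr // mul1r ltrDr.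
have pR : p%:~R <= 0 :> R by rewrite lerz0.
rewrite !rmorphB /= => hs ht; clearbody s t.
(* For [q <= 0] the second value is [(1 + t) - p (1 - t^2) - q t]: no term is positive and the first
   is negative. *)
have [q0|q1] := leP q 0.
  have qR : q%:~R <= 0 :> R by rewrite lerz0.
  have t2 : 0 <= p%:~R * (1 - t ^+ 2) by rewrite mulr_le0 //; nra.
  have qt : 0 <= q%:~R * t by rewrite mulr_le0 //; lra.
  by move: ht qt t2 t1; lra.
(* For [q >= 1] the first value is [p (1 - s^2) + (q - 1) s + s (1 + s)]: no term is positive and
   the last is negative. *)
have qR : 1 <= q%:~R :> R by rewrite ler1z; lia.
have s2 : p%:~R * (1 - s ^+ 2) <= 0 by rewrite mulr_le0_ge0 //; nra.
have qs : (q%:~R - 1) * s <= 0 by rewrite mulr_ge0_le0 //; lra.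
have ss : s * (1 + s) < 0 by rewrite nmulr_rlt0 //; lra.
by move: hs s2 qs ss; lra.
Qed.

End PositiveOnConjugates.

(** * Integral coordinates and indecomposability of [1 + g + g^2] *)

Lemma Zadjoin_basis (K : fieldType) (a : int) (t : K) :
  root (simplest_cubic K a) t -> forall x, Zadjoin t x ->
  exists p q r : int, x = p%:~R + q%:~R * t + r%:~R * t ^+ 2.
Proof.
move=> /simplest_cubic_root3 t3 x [u ->]; elim/poly_ind: u => [|u c [p [q [r h]]]].
  by exists 0, 0, 0; rewrite rmorph0 horner0 !mul0r !addr0.
(* These are the coordinates of [(p + q t + r t^2) t + c] after [t^3] is replaced by
   [a t^2 + (a + 3) t + 1]. *)
exists (r + c), (p + r * (a + 3)), (q + r * a).
rewrite rmorphD rmorphM /= map_polyX map_polyC /= !hornerE h.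
by rewrite !(rmorphD, rmorphM) /=; move: t3; rewrite rmorphD => t3; ring: t3.
Qed.

Definition indecomposable_integer (R : realType) (K : fieldType) (x : K) :=
  OKplus R x /\ forall y z : K, OKplus R y -> OKplus R z -> y + z <> x.

Section SimplestCubicField.
Variables (R : realType) (a : int) (rho : R).
Hypothesis hrho : largest_root (simplest_cubic R a) rho.
Let K := Qadjoin a rho.
Let g : K := Qgen a rho.

Lemma Qgen_root : root (simplest_cubic K a) g.
Proof.
have rr' : root (map_poly (ratr : {rmorphism rat -> R}) (simplest_cubic rat a)) rho.
  by rewrite map_simplest_cubic; exact: hrho.1.
have gE : subfx_inj g = rho := subfx_inj_root rr' (simplest_cubic_neq0 _ _).
rewrite -(fmorph_root (@subfx_inj _ _ _ _ _ : {rmorphism K -> R})).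
by rewrite map_simplest_cubic /= gE; exact: hrho.1.
Qed.

Lemma totally_positive_1_gen_sqr : totally_positive R (1 + g + g ^+ 2).
Proof.
move=> s; rewrite !(rmorphD, rmorphXn) rmorph1.
by set y := s g; nra.
Qed.

Hypothesis hOK : forall x : K, ring_of_integers x <-> Zadjoin g x.

Lemma indecomposable_1_gen_sqr : indecomposable_integer R (1 + g + g ^+ 2).
Proof.
split.
  split; last exact: totally_positive_1_gen_sqr.
  apply/hOK; exists (1 + 'X + 'X^2).
  by rewrite !(rmorphD, rmorphXn) rmorph1 /= map_polyX !hornerE.
have rho_gt0 := largest_root_gt0 hrho.
have rr := hrho.1.
have emb w := @Qadjoin_embedding R a rho w rr.
have [s0 s0E] := emb _ rr.
have [s1 s1E] := emb _ (simplest_cubic_root_conj1 rr).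
have [s2 s2E] := emb _ (simplest_cubic_root_conj2 rr).
have sE (s : {rmorphism K -> R}) (p q r : int) :
    s (p%:~R + q%:~R * g + r%:~R * g ^+ 2) =
    p%:~R + q%:~R * s g + r%:~R * s g ^+ 2.
  by rewrite !(rmorphXn, rmorphD, rmorphM) /= !rmorph_int.
have trace_gt0 p q r : totally_positive R (p%:~R + q%:~R * g + r%:~R * g ^+ 2) ->
    0 < p + r.
  move=> h; rewrite -(ltr0z R) rmorphD /=.
  apply: (@trace_functional_gt0 _ _ rho_gt0 _ q%:~R).
  - by rewrite -s0E -sE; apply: h.
  - by rewrite -s1E -sE; apply: h.
  - by rewrite -s2E -sE; apply: h.
have key (p q r : int) : p <= 0 ->
    totally_positive R (p%:~R + q%:~R * g + r%:~R * g ^+ 2) ->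
    totally_positive R ((1 - p)%:~R + (1 - q)%:~R * g + (1 - r)%:~R * g ^+ 2) ->
    False.
  move=> p0 h h'; have := trace_gt0 _ _ _ h; have := trace_gt0 _ _ _ h' => t' t.
  (* The functional takes positive integer values on both parts, with sum 2. *)
  have rE : r = 1 - p by lia.
  subst r.
  apply: (no_split_on_conjugates rho_gt0 (p := p) (q := q) p0).
    by rewrite -s2E -sE; apply: h.
  rewrite -s1E -[X in X%:~R * _ ^+ 2](_ : 1 - (1 - p) = p); last by ring.
  by rewrite -sE; apply: h'.
move=> x y [/hOK /(Zadjoin_basis Qgen_root) [p [q [r ->]]] xp] [_ yp] e.
have {}e : y = (1 - p)%:~R + (1 - q)%:~R * g + (1 - r)%:~R * g ^+ 2.
  rewrite !rmorphB /=.
  by apply: (addrI (p%:~R + q%:~R * g + r%:~R * g ^+ 2)); rewrite e; ring.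
(* If [p >= 1], the parts trade roles, since then [1 - p <= 0]. *)
subst y; have [p0|p1] := leP p 0; first exact: key xp yp.
apply: (key _ _ _ _ yp); first by lia.
by rewrite !subKr.
Qed.

End SimplestCubicField.

(** * Integrality and values of quadratic forms *)

Section Forms.
Variables (R : realType) (K : fieldType) (sigma : {rmorphism K -> R}).

Lemma ring_of_integersD (x y : K) :
  ring_of_integers x -> ring_of_integers y -> ring_of_integers (x + y).
Proof. exact: integral_add. Qed.

Lemma ring_of_integersM (x y : K) :
  ring_of_integers x -> ring_of_integers y -> ring_of_integers (x * y).
Proof. exact: integral_mul. Qed.

Lemma ring_of_integersN (x : K) : ring_of_integers x -> ring_of_integers (- x).
Proof. exact: integral_opp. Qed.

Lemma ring_of_integers_nat n : ring_of_integers (n%:R : K).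
Proof. exact: (integral_nat (intr : {rmorphism int -> K})). Qed.

Lemma ring_of_integers_sum (I : Type) (r : seq I) (P : pred I) (F : I -> K) :
  (forall i, P i -> ring_of_integers (F i)) ->
  ring_of_integers (\sum_(i <- r | P i) F i).
Proof.
move=> h; apply: (big_ind (@ring_of_integers K)) => //.
  exact: (ring_of_integers_nat 0).
exact: ring_of_integersD.
Qed.

Lemma ring_of_integers_qeval n (Q : 'M[K]_n) x :
  quadratic_form Q -> integral_vector x -> ring_of_integers (qeval Q x).
Proof.
move=> [hQ _] hx; apply: ring_of_integers_sum => i _.
apply: ring_of_integers_sum => j _.
by do 2!apply: ring_of_integersM => //; apply: hx.
Qed.

Lemma qevalE n (Q : 'M[K]_n) x : quadratic_form Q ->
  qeval Q x = (x *m Q *m x^T) 0 0.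
Proof.
move=> [_ hQ]; rewrite -mulmxA mxE; apply: eq_bigr => i _.
rewrite big_mkcond !mxE mulr_sumr /=; apply: eq_bigr => j _.
rewrite !mxE; case: leqP => [_|/hQ ->]; last by rewrite mul0r mulr0.
by rewrite mulrAC mulrC mulrA.
Qed.

(** The sum [Q i j + Q j i] avoids fixing the order of [i] and [j]; for distinct indices one of the
    two is zero. The formula also covers [i = j]. *)
Lemma qeval_plane n (Q : 'M[K]_n) (i j : 'I_n) (s t : K) : quadratic_form Q ->
  qeval Q (s *: delta_mx 0 i + t *: delta_mx 0 j) =
  Q i i * s ^+ 2 + (Q i j + Q j i) * (s * t) + Q j j * t ^+ 2.
Proof.
move=> hQ; rewrite (qevalE _ hQ) linearD /= !linearZ /= !trmx_delta.
rewrite !mulmxDl !mulmxDr -!scalemxAl -!scalemxAr -!rowE -!colE !mxE.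
by ring.
Qed.

Lemma integral_vector_plane n (i j : 'I_n) (s t : K) :
  ring_of_integers s -> ring_of_integers t ->
  integral_vector (s *: delta_mx 0 i + t *: delta_mx 0 j).
Proof.
move=> hs ht k; rewrite !mxE; apply: ring_of_integersD.
  exact/ring_of_integersM/ring_of_integers_nat.
exact/ring_of_integersM/ring_of_integers_nat.
Qed.

Lemma totally_psd_diag n (Q : 'M[K]_n) i : quadratic_form Q ->
  totally_psd R Q -> OKplus R (Q i i) \/ Q i i = 0.
Proof.
move=> hQ pQ; have := pQ (1 *: delta_mx 0 i + 0 *: delta_mx 0 i).
rewrite (qeval_plane _ _ _ _ hQ) expr1n mulr1 !(mulr0, expr0n) !addr0; apply.
apply: integral_vector_plane.
  exact: (ring_of_integers_nat 1).
exact: (ring_of_integers_nat 0).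
Qed.

(* The vector [- (Q j j + 1) e_i + Q_ij e_j] takes the value [- Q_ij ^+ 2]. *)
Lemma totally_psd_diag0 n (Q : 'M[K]_n) (i j : 'I_n) : quadratic_form Q ->
  totally_psd R Q -> i != j -> Q i i = 0 -> Q i j + Q j i = 0.
Proof.
move=> hQ pQ nij Qi0; have [iQ uQ] := hQ.
set b := Q i j + Q j i.
have ib : ring_of_integers b by apply: ring_of_integersD.
have := pQ (- (Q j j + 1) *: delta_mx 0 i + b *: delta_mx 0 j).
rewrite (qeval_plane _ _ _ _ hQ) Qi0 -/b.
have -> : 0 * (- (Q j j + 1)) ^+ 2 + b * (- (Q j j + 1) * b) + Q j j * b ^+ 2
   = - b ^+ 2 by ring.
case.
- apply: integral_vector_plane => //; apply: ring_of_integersN; apply: ring_of_integersD => //.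
  exact: (ring_of_integers_nat 1).
- move=> [_ /(_ sigma)]; rewrite rmorphN rmorphXn oppr_gt0.
  by rewrite ltNge sqr_ge0.
- by move/eqP; rewrite oppr_eq0 expf_eq0 /= => /eqP.
Qed.

(** * Forms whose off-diagonal graph contains a star centred at the first variable *)

Lemma star_additively_indecomposable n (Q : 'M[K]_n.+1) :
  classical Q -> totally_pd R Q ->
  (forall i, indecomposable_integer R (Q i i)) ->
  (forall j, j != ord0 -> Q ord0 j != 0) ->
  additively_indecomposable R Q.
Proof.
move=> cQ pQ ind star; split=> // -[Q1 [Q2 [[c1 p1] [c2 p2] n1 n2 QE]]].
have zero (P : 'M[K]_n.+1) : classical P -> totally_psd R P ->
    (forall i, P i i = 0) -> P = 0.
  move=> [qP _] pP dP; apply/matrixP => i j; rewrite mxE.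
  have [->|nij] := eqVneq i j; first exact: dP.
  have := totally_psd_diag0 qP pP nij (dP i).
  case: (ltngtP i j) => [ij|ij|/val_inj ij].
  - by rewrite (qP.2 j i) // addr0.
  - by rewrite (qP.2 i j).
  - by rewrite ij eqxx in nij.
have dQ i : Q1 i i = 0 \/ Q2 i i = 0.
  have [d1|->] := totally_psd_diag i c1.1 p1; last by left.
  have [d2|->] := totally_psd_diag i c2.1 p2; last by right.
  by case: ((ind i).2 _ _ d1 d2); rewrite QE mxE.
(* If [P] vanishes at the centre, its first row is zero, so [P'] carries each nonzero entry
   [Q ord0 j]. This forces [P' j j] to be nonzero, hence [P j j = 0], and [P] has zero diagonal. *)
have step (P P' : 'M[K]_n.+1) : classical P -> totally_psd R P ->
    classical P' -> totally_psd R P' -> Q = P + P' ->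
    (forall i, P i i = 0 \/ P' i i = 0) -> P ord0 ord0 = 0 -> P = 0.
  move=> cP pP cP' pP' E d P0; apply: zero => // j.
  have [->//|nj] := eqVneq j ord0.
  have [//|P'j] := d j.
  have := star j nj; rewrite E mxE.
  have j0 : (0 < j)%N by rewrite lt0n.
  have := totally_psd_diag0 cP.1 pP _ P0; move=> /(_ j).
  rewrite (cP.1.2 j ord0) // addr0 eq_sym => ->//.
  have := totally_psd_diag0 cP'.1 pP' nj P'j.
  by rewrite (cP'.1.2 j ord0) // !add0r => ->; rewrite eqxx.
have [h|h] := dQ ord0.
  by apply: n1; apply: (step _ Q2).
apply: n2; apply: (step _ Q1) => //; first by rewrite addrC.
by move=> i; have [] := dQ i; [right|left].
Qed.

(** The factor 2 makes the form classical, so [b] lists the Gram matrix entries. The default 0 of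
    [oapp] is never reached, since [j] differs from [i = ord0] in that branch. *)
Definition star_form n (alpha : K) (b : 'I_n -> K) : 'M[K]_n.+1 :=
  \matrix_(i, j) (if i == j then alpha else
    if i == ord0 then oapp (fun k => 2 * b k) 0 (unlift ord0 j) else 0).

Lemma star_form_diag n alpha (b : 'I_n -> K) i : star_form alpha b i i = alpha.
Proof. by rewrite mxE eqxx. Qed.

Lemma star_form_0lift n alpha (b : 'I_n -> K) k :
  star_form alpha b ord0 (lift ord0 k) = 2 * b k.
Proof. by rewrite mxE -val_eqE /= liftK. Qed.

Lemma star_form_lift n alpha (b : 'I_n -> K) k j : lift ord0 k != j ->
  star_form alpha b (lift ord0 k) j = 0.
Proof. by rewrite mxE => /negbTE ->. Qed.

(** Completing the square in every variable but the first; the factor [alpha] avoids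
    denominators. *)
Lemma star_form_eval n alpha (b : 'I_n -> K) (x : 'rV[K]_n.+1) :
  alpha * qeval (star_form alpha b) x =
  \sum_k (alpha * x 0 (lift ord0 k) + b k * x 0 ord0) ^+ 2
  + (alpha ^+ 2 - \sum_k b k ^+ 2) * x 0 ord0 ^+ 2.
Proof.
rewrite /qeval big_ord_recl (big_ord_recl n) /= star_form_diag.
under eq_bigr do rewrite star_form_0lift.
have -> : \sum_(i < n) \sum_(j < n.+1 | (lift ord0 i <= j)%N)
    star_form alpha b (lift ord0 i) j * x 0 (lift ord0 i) * x 0 j =
    \sum_(i < n) alpha * x 0 (lift ord0 i) ^+ 2.
  apply: eq_bigr => i _; rewrite (bigD1 (lift ord0 i)) //= star_form_diag.
  rewrite big1 ?addr0 => [|j /andP[_ ?]]; first by rewrite -mulrA.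
  by rewrite star_form_lift 1?eq_sym // !mul0r.
have -> : \sum_k (alpha * x 0 (lift ord0 k) + b k * x 0 ord0) ^+ 2 =
    alpha * (\sum_k 2 * b k * x 0 ord0 * x 0 (lift ord0 k))
    + alpha * (\sum_k alpha * x 0 (lift ord0 k) ^+ 2)
    + (\sum_k b k ^+ 2) * x 0 ord0 ^+ 2.
  rewrite !mulr_sumr mulr_suml -!big_split /=.
  by apply: eq_bigr => k _; ring.
by ring.
Qed.

Lemma star_form_classical n alpha (b : 'I_n -> K) :
  ring_of_integers alpha -> (forall k, ring_of_integers (b k)) ->
  classical (star_form alpha b).
Proof.
move=> ia ib.
have i0 := ring_of_integers_nat 0.
have off (i j : 'I_n.+1) : i != j ->
    exists c, ring_of_integers c /\ star_form alpha b i j = 2 * c.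
  move=> nij; rewrite mxE (negbTE nij); case: ifP => _; last first.
    by exists 0; rewrite mulr0.
  case: unliftP => [k _|_] /=; first by exists (b k).
  by exists 0; rewrite mulr0.
split; last exact: off.
split=> i j.
  have [->|/off [c [ic ->]]] := eqVneq i j; first by rewrite star_form_diag.
  by apply: ring_of_integersM => //; exact: ring_of_integers_nat.
by move=> ji; rewrite mxE -!val_eqE /= gtn_eqF //; case: (i : nat) ji.
Qed.

Lemma star_form_totally_pd n alpha (b : 'I_n -> K) :
  ring_of_integers alpha -> (forall k, ring_of_integers (b k)) ->
  totally_positive R alpha ->
  totally_positive R (alpha ^+ 2 - \sum_k b k ^+ 2) ->
  totally_pd R (star_form alpha b).
Proof.
move=> ia ib pa pd; have [qQ _] := star_form_classical ia ib.
have ev (s : {rmorphism K -> R}) x :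
    s alpha * s (qeval (star_form alpha b) x) =
    \sum_k s (alpha * x 0 (lift ord0 k) + b k * x 0 ord0) ^+ 2
    + s (alpha ^+ 2 - \sum_k b k ^+ 2) * s (x 0 ord0) ^+ 2.
  rewrite -rmorphM star_form_eval rmorphD rmorph_sum rmorphM rmorphXn /=.
  by congr (_ + _); apply: eq_bigr => k _; rewrite rmorphXn.
split=> x ix.
  have [->|nz] := eqVneq (qeval (star_form alpha b) x) 0; first by right.
  left; split; first exact: ring_of_integers_qeval.
  move=> s; rewrite lt_def fmorph_eq0 nz /= -(pmulr_rge0 _ (pa s)) ev.
  apply: addr_ge0; last exact: mulr_ge0 (ltW (pd s)) (sqr_ge0 _).
  by apply: sumr_ge0 => k _; exact: sqr_ge0.
(* Definiteness is read off at the single embedding [sigma]: every term is zero, which gives first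
   [x 0 ord0 = 0], then [alpha * x 0 (lift ord0 k) = 0] for each [k]. *)
move=> q0; have := ev sigma x; rewrite q0 rmorph0 mulr0 => /esym/eqP.
rewrite paddr_eq0; last 2 first.
- by apply: sumr_ge0 => k _; exact: sqr_ge0.
- exact: mulr_ge0 (ltW (pd sigma)) (sqr_ge0 _).
rewrite mulf_eq0 (gt_eqF (pd sigma)) /= expf_eq0 /= fmorph_eq0.
rewrite psumr_eq0 => [/andP[/allP sq /eqP x0]|k _]; last exact: sqr_ge0.
have a0 : alpha != 0 by rewrite -(fmorph_eq0 sigma) gt_eqF.
apply/rowP => i; rewrite mxE; case: (unliftP ord0 i) => [k|] -> //.
have := sq k (mem_index_enum _); rewrite /= expf_eq0 /= fmorph_eq0 x0 mulr0 addr0.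
by rewrite mulf_eq0 (negbTE a0) => /eqP.
Qed.

Lemma star_form_indecomposable n alpha (b : 'I_n -> K) :
  indecomposable_integer R alpha -> (forall k, ring_of_integers (b k)) ->
  (forall k, b k != 0) ->
  totally_positive R (alpha ^+ 2 - \sum_k b k ^+ 2) ->
  additively_indecomposable R (star_form alpha b).
Proof.
move=> inda ib nb pd; have [ia pa] := inda.1.
apply: star_additively_indecomposable.
- exact: star_form_classical.
- exact: star_form_totally_pd.
- by move=> i; rewrite star_form_diag.
- move=> j; case: (unliftP ord0 j) => [k ->|->]; last by rewrite eqxx.
  (* That 2 is nonzero in [K] is checked in [R] through [sigma]. *)
  rewrite star_form_0lift mulf_neq0 // -(fmorph_eq0 sigma) rmorph_nat.
  by rewrite pnatr_eq0.
Qed.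

End Forms.

(** * The binary and the ternary form *)

Theorem theorem1p2 (R : realType) (a : int) (rho : R)
  (ha : -1 <= a)
  (hrho : largest_root (simplest_cubic R a) rho)
  (hOK : forall x : Qadjoin a rho,
      ring_of_integers x <-> Zadjoin (Qgen a rho) x) :
  (exists Q : 'M[Qadjoin a rho]_2, additively_indecomposable R Q) /\
  (exists Q : 'M[Qadjoin a rho]_3, additively_indecomposable R Q).
Proof.
(* At least one real embedding must exist, as total positivity would otherwise be vacuous. *)
have [sigma _] := Qadjoin_embedding hrho.1 hrho.1.
set g := Qgen a rho in hOK.
have ind := indecomposable_1_gen_sqr hrho hOK.
have rg := Qgen_root hrho.
have g0 := simplest_cubic_root_neq0 rg.
have g1 := simplest_cubic_root_add1_neq0 rg.
have ig : ring_of_integers g by apply/hOK; exists 'X; rewrite map_polyX hornerX.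
have ig1 : ring_of_integers (1 + g).
  by apply/hOK; exists (1 + 'X); rewrite rmorphD rmorph1 /= map_polyX !hornerE.
have sq_gt0 (s : {rmorphism Qadjoin a rho -> R}) x : x != 0 -> 0 < s x ^+ 2.
  by move=> x0; rewrite exprn_even_gt0 //= fmorph_eq0.
split.
  exists (star_form (1 + g + g ^+ 2) (fun _ : 'I_1 => g)).
  apply: (star_form_indecomposable sigma) => // s; rewrite big_ord1.
  have -> : (1 + g + g ^+ 2) ^+ 2 - g ^+ 2 = (1 + g) ^+ 2 + (g * (1 + g)) ^+ 2.
    by ring.
  by rewrite rmorphD !rmorphXn addr_gt0 // sq_gt0 // mulf_neq0.
exists (star_form (1 + g + g ^+ 2) (fun k : 'I_2 => if k == 0 then g else 1 + g)).
apply: (star_form_indecomposable sigma) => // [k|k|s]; try by case: ifP.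
rewrite !big_ord_recl big_ord0 /=.
have -> : (1 + g + g ^+ 2) ^+ 2 - (g ^+ 2 + ((1 + g) ^+ 2 + 0)) =
    (g * (1 + g)) ^+ 2 by ring.
by rewrite rmorphXn sq_gt0 // mulf_neq0.
Qed.
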